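(* Let $k$ be an algebraically closed field of characteristic $p>0$, let $r\ge 3$, let $E_r$ be a $p$-elementary abelian group of rank $r$, and let $(c,d)\in\mathbb{N}_0^2$ be such that $r-1\le c\le (r-2)d$. Then the full subcategory of finite-dimensional $kE_r$-modules with the equal kernels property that have constant Jordan type $[1]^{cn}[2]^{dn}$ for some $n\in\mathbb{N}$ has wild representation type.
   Context: $\mathbb{N}=\{1,2,\dots\}$, $\mathbb{N}_0=\mathbb{N}\cup\{0\}$. Choose generators $g_1,\dots,g_r$ of $E_r\cong(\mathbb{Z}/p)^r$ and put $x_i:=g_i-1\in kE_r$, so $kE_r\cong k[X_1,\dots,X_r]/(X_1^p,\dots,X_r^p)$ via $x_i\mapsto X_i$. For $\alpha\in k^r\setminus\{0\}$ put $x_\alpha:=\sum_{i=1}^r\alpha_i x_i$ and, for a finite-dimensional $kE_r$-module $M$, let $x_\alpha^M\colon M\to M$, $m\mapsto x_\alpha.m$ (a nilpotent operator). $M$ has constant Jordan type $[1]^a[2]^b$ if for every $\alpha\in k^r\setminus\{0\}$ the Jordan canonical form of $x_\alpha^M$ consists of exactly $a$ blocks of size $1$ and $b$ blocks of size $2$. $M$ has the equal kernels property if $\ker x_\alpha^M$ does not depend on $\alpha\in k^r\setminus\{0\}$. Wild representation type is meant in the usual sense: there is a $kE_r$-$k\langle X,Y\rangle$-bimodule $B$, free of finite rank over the free algebra $k\langle X,Y\rangle$, such that the functor $B\otimes_{k\langle X,Y\rangle}-$ from non-zero finite-dimensional $k\langle X,Y\rangle$-modules to finite-dimensional $kE_r$-modules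 has values in the given subcategory, preserves indecomposability and reflects isomorphisms. *)

(* Defs.v *)
From HB Require Import structures.
From mathcomp Require Import all_boot all_order all_algebra all_fingroup.
From mathcomp Require Import all_solvable all_character.
From mathcomp Require Import finmap.
From mathcomp.multinomials Require Import monalg.

Set Implicit Arguments.
Unset Strict Implicit.
Unset Printing Implicit Defensive.

Import GRing.Theory.
Local Open Scope ring_scope.

(* All modules are spaces of row vectors, on which an algebra element acts    *)
(* through right multiplication by a matrix. For an abelian group G a matrix  *)
(* representation of G is thus the same thing as a left kG-module.            *)

Section JordanForm.

Variable F : fieldType.

Definition nilp_jordan_block (n : nat) : 'M[F]_n :=
  \matrix_(i < n, j < n) (i.+1 == j :> nat)%:R.

Definition nilp_jordan_mx (s : seq nat) :
    'M[F]_(\sum_(i < size s) nth 0%N s i) :=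
  \mxdiag_(i < size s) nilp_jordan_block (nth 0%N s i).

(* P is an invertible change of basis: it is square, because it has full row  *)
(* rank and full column rank.                                                 *)
Definition has_nilp_jordan_form (n : nat) (A : 'M[F]_n) (s : seq nat) : Prop :=
  exists P : 'M[F]_(n, \sum_(i < size s) nth 0%N s i),
    [/\ row_free P, row_full P & A *m P = P *m nilp_jordan_mx s].

End JordanForm.

Section GroupModules.

Variables (F : fieldType) (gT : finGroupType) (G : {group gT}).

Definition mx_indecomposable n (rG : mx_representation F G n) : Prop :=
  (0 < n)%N /\
  forall U V : 'M[F]_n, mxmodule rG U -> mxmodule rG V ->
    (U + V == 1%:M)%MS -> (U :&: V = 0)%MS -> U = 0 \/ V = 0.

Variables (r : nat) (g : 'I_r -> gT).

Definition x_op n (rG : mx_representation F G n) (alpha : 'rV[F]_r) : 'M[F]_n :=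
  \sum_(i < r) alpha 0 i *: (rG (g i) - 1%:M).

Definition constant_jordan_type12 n (rG : mx_representation F G n)
    (a b : nat) : Prop :=
  forall alpha : 'rV[F]_r, alpha != 0 ->
    has_nilp_jordan_form (x_op rG alpha) (nseq a 1%N ++ nseq b 2%N).

Definition equal_kernels n (rG : mx_representation F G n) : Prop :=
  forall alpha beta : 'rV[F]_r, alpha != 0 -> beta != 0 ->
    (kermx (x_op rG alpha) == kermx (x_op rG beta))%MS.

End GroupModules.

(* The free algebra k<X,Y>: the monoid algebra of the words in two letters.   *)
Notation free_alg2 F := {malg F[{fmonom 'I_2}]}.

Section FreeAlgebraModules.

Variable F : fieldType.

(* A left k<X,Y>-module structure on k^n is an arbitrary pair of              *)
(* endomorphisms.                                                             *)
Definition fa_module (n : nat) : Type := 'I_2 -> 'M[F]_n.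

(* The first letter of a word acts last.                                      *)
Definition word_act n (N : fa_module n) (w : {fmonom 'I_2}) (v : 'rV[F]_n) :
    'rV[F]_n :=
  foldr (fun i u => u *m N i) v (w : seq 'I_2).

Definition fa_act n (N : fa_module n) (a : free_alg2 F) (v : 'rV[F]_n) :
    'rV[F]_n :=
  \sum_(w <- msupp a) a@_w *: word_act N w v.

Definition fa_isomorphic n1 (N1 : fa_module n1) n2 (N2 : fa_module n2) : Prop :=
  exists P : 'M[F]_(n1, n2),
    [/\ row_free P, row_full P & forall i, N1 i *m P = P *m N2 i].

Definition fa_indecomposable n (N : fa_module n) : Prop :=
  (0 < n)%N /\
  forall U V : 'M[F]_n,
    (forall i, stablemx U (N i)) -> (forall i, stablemx V (N i)) ->
    (U + V == 1%:M)%MS -> (U :&: V = 0)%MS -> U = 0 \/ V = 0.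

Lemma word_act_linear n (N : fa_module n) w : linear (word_act N w).
Proof.
move=> c u v; rewrite /word_act; elim: (w : seq _) => //= i s ->.
by rewrite mulmxDl -scalemxAl.
Qed.

Lemma fa_act_linear n (N : fa_module n) a : linear (fa_act N a).
Proof.
move=> c u v; rewrite /fa_act scaler_sumr -big_split; apply: eq_bigr => w _ /=.
by rewrite word_act_linear scalerDr !scalerA mulrC.
Qed.

HB.instance Definition _ n (N : fa_module n) w :=
  GRing.isLinear.Build F 'rV[F]_n 'rV[F]_n _ (word_act N w)
    (word_act_linear N w).
HB.instance Definition _ n (N : fa_module n) a :=
  GRing.isLinear.Build F 'rV[F]_n 'rV[F]_n _ (fa_act N a) (fa_act_linear N a).

Lemma fa_actEw n (N : fa_module n) (d : {fset {fmonom 'I_2}}) a v :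
    (msupp a `<=` d)%fset ->
  fa_act N a v = \sum_(w <- d) a@_w *: word_act N w v.
Proof.
move=> sad; rewrite /fa_act; apply: big_fset_incl => // w _ /mcoeff_outdom ->.
by rewrite scale0r.
Qed.

Lemma fa_actU n (N : fa_module n) c w v :
  fa_act N << c *g w >> v = c *: word_act N w v.
Proof. by rewrite (fa_actEw _ _ msuppU_le) big_seq_fset1 mcoeffUU. Qed.

Lemma fa_actD n (N : fa_module n) a b v :
  fa_act N (a + b) v = fa_act N a v + fa_act N b v.
Proof.
have sUl := fsubsetUl (msupp a) (msupp b).
have sUr := fsubsetUr (msupp a) (msupp b).
rewrite (fa_actEw _ _ (msuppD_le _ _)) (fa_actEw _ _ sUl) (fa_actEw _ _ sUr).
by rewrite -big_split; apply: eq_bigr => w _; rewrite mcoeffD scalerDl.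
Qed.

Lemma fa_act0 n (N : fa_module n) v : fa_act N 0 v = 0.
Proof. by rewrite /fa_act msupp0 big_seq_fset0. Qed.

Lemma fa_act_sum n (N : fa_module n) I (s : seq I) (A : I -> free_alg2 F) v :
  fa_act N (\sum_(i <- s) A i) v = \sum_(i <- s) fa_act N (A i) v.
Proof.
exact: (big_morph (fun a => fa_act N a v) (fun a b => fa_actD N a b v)
  (fa_act0 N v)).
Qed.

Lemma fa_act1 n (N : fa_module n) v : fa_act N 1 v = v.
Proof. by rewrite [1]/(<< 1 *g _ >>) fa_actU scale1r /word_act fm1. Qed.

Lemma fa_actM n (N : fa_module n) a b v :
  fa_act N (a * b) v = fa_act N a (fa_act N b v).
Proof.
rewrite malgME fa_act_sum {2}/fa_act; apply: eq_bigr => w _.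
rewrite fa_act_sum {2}/fa_act linear_sum scaler_sumr; apply: eq_bigr => w' _.
by rewrite fa_actU linearZ scalerA /word_act fmM foldr_cat.
Qed.

End FreeAlgebraModules.

Section Wild.

Variables (F : fieldType) (gT : finGroupType) (G : {group gT}).

(* A kG-k<X,Y>-bimodule that is free of rank m over A = k<X,Y>, written as    *)
(* A^m with A acting by right multiplication: its right A-linear              *)
(* endomorphisms are the m x m matrices over A acting on columns.             *)
Record free_bimodule (m : nat) := FreeBimodule {
  bimod_mx :> gT -> 'M[free_alg2 F]_m;
  bimod_mx1 : bimod_mx 1%g = 1%:M;
  bimod_mxM : {in G &, forall x y, bimod_mx (x * y)%g = bimod_mx x *m bimod_mx y}
}.

Variables (m : nat) (B : free_bimodule m) (n : nat) (N : fa_module F n).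

(* B (x)_A N is identified with N^m, that is with the m x n matrices whose    *)
(* rows are the m components in N = k^n, through                              *)
(* (a_1, ..., a_m) (x) v |-> (a_1 v, ..., a_m v).                             *)
Definition tensor_act (x : gT) (w : 'M[F]_(m, n)) : 'M[F]_(m, n) :=
  \matrix_(i < m) \sum_(j < m) fa_act N (B x i j) (row j w).

Lemma tensor_act_linear x : linear (tensor_act x).
Proof.
move=> c u v; apply/row_matrixP => i; rewrite linearP /= !rowK.
rewrite scaler_sumr -big_split; apply: eq_bigr => j _ /=.
by rewrite !linearP.
Qed.

HB.instance Definition _ x :=
  GRing.isLinear.Build F 'M[F]_(m, n) 'M[F]_(m, n) _ (tensor_act x)
    (tensor_act_linear x).

Lemma tensor_act1 w : tensor_act 1%g w = w.
Proof.
apply/row_matrixP => i; rewrite rowK bimod_mx1 (bigD1 i) //= mxE eqxx fa_act1.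
rewrite big1 ?addr0 // => j /negbTE ne_ji.
by rewrite mxE eq_sym ne_ji fa_act0.
Qed.

Lemma tensor_actM : {in G &, forall x y w,
  tensor_act (x * y)%g w = tensor_act x (tensor_act y w)}.
Proof.
move=> x y Gx Gy w; apply/row_matrixP => i; rewrite !rowK bimod_mxM //.
under eq_bigr do rewrite mxE fa_act_sum.
rewrite exchange_big; apply: eq_bigr => l _ /=.
by rewrite rowK linear_sum; apply: eq_bigr => j _; rewrite fa_actM.
Qed.

Hypothesis cGG : abelian G.

Lemma tensor_mx_repr : mx_repr G (fun x => lin_mx (tensor_act x)).
Proof.
split=> [|x y Gx Gy].
  apply/row_matrixP => i; rewrite !rowE mul_rV_lin /= tensor_act1 vec_mxK.
  by rewrite mulmx1.
apply/row_matrixP => i; rewrite !rowE mulmxA !mul_rV_lin /= mxvecK.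
by rewrite -tensor_actM // (centsP cGG x Gx y Gy).
Qed.

Definition tensor_repr : mx_representation F G (m * n) :=
  MxRepresentation tensor_mx_repr.

End Wild.

(* C is a class of finite-dimensional modules over the abelian group G,       *)
(* viewed as a full subcategory.                                              *)
Definition wild_representation_type (F : fieldType) (gT : finGroupType)
    (G : {group gT}) (cGG : abelian G)
    (C : forall n, mx_representation F G n -> Prop) : Prop :=
  exists (m : nat) (B : free_bimodule F G m),
    [/\ forall n (N : fa_module F n), (0 < n)%N -> C _ (tensor_repr B N cGG),
        forall n (N : fa_module F n),
          fa_indecomposable N -> mx_indecomposable (tensor_repr B N cGG)
      & forall n1 (N1 : fa_module F n1) n2 (N2 : fa_module F n2),
          (0 < n1)%N -> (0 < n2)%N ->
          mx_rsim (tensor_repr B N1 cGG) (tensor_repr B N2 cGG) ->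
          fa_isomorphic N1 N2].

(* Main.v *)
Require Import Defs.
From HB Require Import structures.
From mathcomp Require Import all_boot all_order all_algebra all_fingroup.
From mathcomp Require Import all_solvable all_character.
From mathcomp Require Import zify.
From mathcomp.multinomials Require Import monalg.

Set Implicit Arguments.
Unset Strict Implicit.
Unset Printing Implicit Defensive.

Import GRing.Theory.
Local Open Scope ring_scope.

(** The modules are extensions of a trivial module by a trivial module, that
is, representations of the Kronecker quiver with r arrows x_0, ..., x_(r-1)
going from N^d to N^(c+d); all products x_i x_j vanish, and g_i acts as
1 + x_i. If x_alpha is injective on N^d for every nonzero alpha, its kernel
on the whole module is N^(c+d), independently of alpha, and its Jordan type
has dim N^d = dn blocks of size 2 and (c+d)n - dn = cn blocks of size 1. So it
suffices to find arrows, with entries in k<X,Y>, which have this injectivity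
for every N and which are rigid enough to remember N.

Write e_0, ..., e_(d-1) and f_0, ..., f_(c+d-1) for the standard bases. The
arrows are shifts x_i e_j = f_(j+s_i), with 0 = s_0 < 1 = s_1 < s_2 < ... <=
c, except that
  x_1 e_(d-1) = f_d + X f_(d-1) + Y f_(d-2).
Multiplication by x_alpha then resembles the product of the polynomials
sum alpha_i t^(s_i) and sum v_j t^j: the top coefficient of the product is
the product of the top coefficients, and the terms in X and Y only occur
strictly below it. This gives injectivity (kron_act_inj).

A homomorphism of Kronecker representations from N^d, N^(c+d) to N'^d,
N'^(c+d) is 1 (x) h for a k<X,Y>-linear h (kron_full). The relations
x_1 e_j = x_0 e_(j+1) make the map on N^d commute with the shift; the last
of the d coordinates must then vanish on each image of e_j with j < d-1,
which leaves a block scalar matrix h. If every f_l is some x_i e_j with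
i <> 1, the map on N^(c+d) is also given by h, and the equation for
x_1 e_(d-1) says that h commutes with X and Y. Asking that the intervals
[s_i, s_i + d) with i = 0 and i >= 2 cover [0, c + d) means s_2 <= d and
s_(i+1) <= s_i + d for i >= 2, so s_(r-1) = c can be reached exactly when c <= (r-2)d,
while strict monotonicity needs c >= r-1: these are the bounds on c in the
theorem (shifts_exist).

A homomorphism of group algebra modules preserves N^(c+d), the common kernel
of the x_alpha, so it induces a homomorphism of Kronecker representations
(kron_hom). An isomorphism thus induces an isomorphism of the k<X,Y>-modules.
An idempotent endomorphism induces an idempotent h, which is 0 or 1 when N is
indecomposable; the endomorphism then differs from 0 or 1 by an idempotent
that is also nilpotent (kron_idempotent). *)

(** * Square-zero matrices and their Jordan form *)

Section SquareZero.

Variable F : fieldType.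

Lemma row_base_of_rank m n b (A : 'M[F]_(m, n)) :
  \rank A = b -> exists2 R : 'M_(b, n), row_free R & (R <= A)%MS.
Proof.
move=> <-; exists (row_base A); first exact: row_base_free.
by rewrite eq_row_base.
Qed.

(** A basis adapted to im A inside ker A: preimages W of a basis R of the image,
then R itself, then a basis C of a complement of the image in the kernel. *)
Lemma square_zero_normal_form b c (A : 'M[F]_(b + (b + c))) :
    A *m A = 0 -> \rank A = b ->
  exists2 Q, Q \in unitmx & Q *m A = block_mx 0 (row_mx 1%:M 0) 0 0 *m Q.
Proof.
move=> AA0 rA.
have sAK : (A <= kermx A)%MS by apply/sub_kermxP.
have rC : \rank (kermx A :\: A)%MS = c.
  have := mxrank_cap_compl (kermx A) A.
  rewrite (capmx_idPr sAK) mxrank_ker rA addKn; exact: addnI.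
have [R Rfree sRA] := row_base_of_rank rA.
have [C Cfree sCD] := row_base_of_rank rC.
have /submxP[W defR] := sRA.
have RA0 : R *m A = 0 by apply/sub_kermxP/(submx_trans sRA).
have CA0 : C *m A = 0 by apply/sub_kermxP/(submx_trans sCD)/diffmxSl.
exists (col_mx W (col_mx R C)); last first.
  rewrite mul_block_col mul_row_col !mul_col_mx RA0 CA0 -defR.
  by rewrite !mul0mx mul1mx !add0r addr0 col_mx0.
rewrite -row_free_unit -kermx_eq0; apply/eqP/row_matrixP => i; rewrite row0.
have: row i (kermx (col_mx W (col_mx R C))) *m col_mx W (col_mx R C) = 0.
  by rewrite -row_mul mulmx_ker row0.
move: (row i _) => u; rewrite -[u]hsubmxK -[rsubmx u]hsubmxK !mul_row_col.
move: (lsubmx u) (lsubmx (rsubmx u)) (rsubmx (rsubmx u)) => u1 u2 u3 uQ0.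
have u10 : u1 = 0.
  apply: (row_free_inj Rfree); rewrite mul0mx defR mulmxA.
  have := congr1 (fun v => v *m A) uQ0; rewrite mul0mx !mulmxDl.
  by rewrite -(mulmxA u2) -(mulmxA u3) RA0 CA0 !mulmx0 !addr0.
have u2R : u2 *m R = - (u3 *m C).
  by apply/eqP; rewrite -addr_eq0; rewrite u10 mul0mx add0r in uQ0; apply/eqP.
have u20R : u2 *m R = 0.
  apply/eqP; rewrite -submx0 -(capmx_diff (kermx A) A) sub_capmx.
  apply/andP; split.
    rewrite u2R eqmx_opp; exact: submx_trans (submxMl _ _) sCD.
  exact: submx_trans (submxMl _ _) sRA.
have u20 : u2 = 0 by apply: (row_free_inj Rfree); rewrite u20R mul0mx.
have u30 : u3 = 0.
  apply: (row_free_inj Cfree); rewrite mul0mx; apply: oppr_inj.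
  by rewrite -u2R u20R oppr0.
by rewrite u10 u20 u30 !row_mx0.
Qed.

(** Rank and size determine a square-zero matrix up to similarity, which turns
the computation of a Jordan form into that of a rank. *)
Lemma square_zero_similar n n' b c (A : 'M[F]_n) (A' : 'M[F]_n') :
    n = (b + (b + c))%N -> n' = (b + (b + c))%N ->
    A *m A = 0 -> A' *m A' = 0 -> \rank A = b -> \rank A' = b ->
  exists P : 'M_(n, n'), [/\ row_free P, row_full P & A *m P = P *m A'].
Proof.
move=> en en'; subst n n' => AA0 AA0' rA rA'.
have [Q Qu QA] := square_zero_normal_form AA0 rA.
have [Q' Qu' QA'] := square_zero_normal_form AA0' rA'.
have Pu : invmx Q *m Q' \in unitmx by rewrite unitmx_mul unitmx_inv Qu.
exists (invmx Q *m Q'); split; rewrite ?row_free_unit ?row_full_unit //.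
by rewrite -[RHS]mulmxA QA' -[A](mulKmx Qu) QA -!mulmxA mulKVmx.
Qed.

Lemma nilp_jordan12_square_zero s :
  all (fun n => n <= 2)%N s -> nilp_jordan_mx F s *m nilp_jordan_mx F s = 0.
Proof.
move=> /all_nthP s2; rewrite /nilp_jordan_mx.
rewrite {2}/mxdiag mul_mxdiag_mxblock -[RHS]mxdiag0; apply/eq_mxblockP => i j.
case: eqP => [->|_]; last by rewrite mulmx0.
rewrite !conform_mx_id; apply/matrixP => k l; rewrite !mxE big1 // => m _.
rewrite !mxE -natrM mulnb; have := s2 0%N j (ltn_ord j).
have := ltn_ord k; have := ltn_ord l.
move: (nat_of_ord k) (nat_of_ord l) (nat_of_ord m) => k' l' m' lt_l _ le2.
case: eqP => //= <-; case: eqP => //= el; move: (leq_trans lt_l le2).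
by rewrite -el.
Qed.

Lemma rank_nilp_jordan12 a b :
  \rank (nilp_jordan_mx F (nseq a 1 ++ nseq b 2)) = b.
Proof.
rewrite /nilp_jordan_mx rank_mxdiag.
pose rk n := \rank (nilp_jordan_block F n).
rewrite -(big_mkord xpredT (fun i => rk (nth 0%N _ i))).
rewrite -(big_nth 0%N xpredT rk) /rk.
rewrite big_cat !big_nseq /=.
have -> : nilp_jordan_block F 1 = 0.
  by apply/matrixP => i j; rewrite !ord1 !mxE.
have -> : nilp_jordan_block F 2 = delta_mx 0 1.
  apply/matrixP => i j; rewrite !mxE.
  by case: i j => [[|[|//]] ?] [[|[|//]] ?].
rewrite mxrank0 mxrank_delta !iter_addn_0; lia.
Qed.

End SquareZero.

(** * Coordinates on an elementary abelian group *)

Lemma natr_Fp_add (k : fieldType) p (charkp : p \in [pchar k]) (a b : 'F_p) :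
  ((a + b)%R : 'F_p)%:R = a%:R + b%:R :> k.
Proof.
have pr_p := pcharf_prime charkp.
rewrite -natrD -(GRing.natr_mod_pchar charkp (a + b)%N) /=.
by congr (_ %% _)%:R; apply: Fp_cast.
Qed.

(** A generating family of r elements in rank r is a basis of E over the prime
field, and chi is the dual basis, with values read in k. *)
Lemma abelem_coordinates (k : fieldType) p (charkp : p \in [pchar k]) r
    (gT : finGroupType) (E : {group gT}) (abelE : (p.-abelem E)%g)
    (rankE : 'r(E)%g = r) (r_gt0 : (0 < r)%N)
    (g : 'I_r -> gT) (genE : <<[set g i | i : 'I_r]>>%g = E) :
  exists chi : gT -> 'I_r -> k,
    (forall i, {in E &, {morph chi ^~ i : x y / (x * y)%g >-> x + y}}) /\
    (forall i j, chi (g j) i = (j == i)%:R).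
Proof.
have ntE : E :!=: 1%g by apply: contraTneq r_gt0 => E1; rewrite -rankE E1 rank1.
pose ErV := abelem_rV abelE ntE.
pose Gamma := \matrix_(i < r) ErV (g i).
have gE i : g i \in E by rewrite -genE mem_gen // imset_f.
have full_Gamma : row_full Gamma.
  rewrite -sub1mx; apply/row_subP => i; set v := row i _.
  rewrite -[v](rVabelemK abelE ntE) -mem_rowg; set x := rVabelem _ _ v.
  (* The elements whose coordinate vector lies in the span of the g_i form a
     subgroup containing the generators. *)
  have: x \in (ErV @*^-1 rowg_group Gamma)%g; last by case/morphpreP.
  have: x \in E by exact: mem_rVabelem.
  rewrite -[in X in X -> _]genE; apply/subsetP; rewrite gen_subG.
  apply/subsetP => _ /imsetP[j _ ->]; rewrite mem_morphpre //=.
  by rewrite mem_rowg; have := row_sub j Gamma; rewrite rowK.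
have /row_freeP[D GammaD] : row_free Gamma.
  rewrite /row_free (eqP full_Gamma) -rankE (rank_abelem abelE).
  by rewrite -(dim_abelemE abelE ntE).
exists (fun x i => ((ErV x *m D) 0 i)%:R); split=> [i x y Ex Ey | i j].
  by rewrite /ErV abelem_rV_M // mulmxDl mxE (natr_Fp_add charkp).
have <- : row j Gamma = ErV (g j) by rewrite rowK.
rewrite -row_mul GammaD !mxE.
by case: eqP.
Qed.

(** * Block rows and basis vectors *)

Section Components.

Variables (F : fieldType) (m n : nat).
Implicit Types (v w : 'M[F]_(m, n)) (y : 'rV[F]_n) (i j : nat).

(** An m x n matrix stands for an element of N^m, with rows indexed here by
natural numbers so that shifted positions need no proof of being in range:
a row out of range is zero, and slot j y is e_j (x) y. *)
Definition nrow j v : 'rV[F]_n := if insub j is Some o then row o v else 0.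

Definition slot j y : 'M[F]_(m, n) := \matrix_(i < m) (y *+ (i == j :> nat)).

Lemma nrow_ord v (o : 'I_m) : nrow o v = row o v.
Proof. by rewrite /nrow valK. Qed.

Lemma nrow_out v j : (m <= j)%N -> nrow j v = 0.
Proof. by move=> lemj; rewrite /nrow insubF // ltnNge lemj. Qed.

Lemma nrow_eq v w : (forall j, (j < m)%N -> nrow j v = nrow j w) -> v = w.
Proof.
by move=> eq_vw; apply/row_matrixP => o; rewrite -!nrow_ord; apply: eq_vw.
Qed.

Lemma nrow_is_linear j : linear (nrow j).
Proof.
move=> a v w; rewrite /nrow; case: insubP => [o _ _|_]; first exact: linearP.
by rewrite scaler0 addr0.
Qed.

HB.instance Definition _ j :=
  GRing.isLinear.Build F 'M[F]_(m, n) 'rV[F]_n _ (nrow j) (nrow_is_linear j).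

Lemma nrow_slot j y i : (j < m)%N -> nrow i (slot j y) = y *+ (i == j).
Proof.
move=> lt_jm; rewrite /nrow; case: insubP => [o _ <-|]; first exact: rowK.
rewrite -leqNgt => le_mi; case: eqP => // eij.
by move: lt_jm; rewrite -eij ltnNge le_mi.
Qed.

Lemma slot_is_linear j : linear (slot j).
Proof.
move=> a y z; apply/row_matrixP => o; rewrite linearP /= !rowK mulrnDl.
by rewrite scalerMnr.
Qed.

HB.instance Definition _ j :=
  GRing.isLinear.Build F 'rV[F]_n 'M[F]_(m, n) _ (slot j) (slot_is_linear j).

Lemma slot_sum v : v = \sum_(j < m) slot j (nrow j v).
Proof.
apply: nrow_eq => i lt_im; rewrite linear_sum (bigD1 (Ordinal lt_im)) //=.
rewrite nrow_slot // eqxx big1 ?addr0 // => j ne_ji.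
by rewrite nrow_slot // eq_sym -val_eqE /= in ne_ji *; rewrite (negPf ne_ji).
Qed.

End Components.
Arguments slot {F} m {n} j y.

Lemma slotM (F : fieldType) m n n' j (y : 'rV[F]_n) (h : 'M_(n, n')) :
  slot m j y *m h = slot m j (y *m h).
Proof.
apply/row_matrixP => o; rewrite row_mul !rowK.
by case: (_ == _); rewrite ?mul0mx.
Qed.

(** * Shift sequences *)

(** The last two conditions bound the image of every shift by N^(c+d) and make
every f_l an unperturbed shift: f_0, ..., f_(d-1) through s_0 and the others
through some s_i with i >= 2. *)
Record admissible_shifts (c d r : nat) (s : nat -> nat) : Prop :=
  AdmissibleShifts {
    shifts_d_gt1 : (1 < d)%N;
    shifts_r_gt2 : (2 < r)%N;
    shifts0 : s 0 = 0%N;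
    shifts1 : s 1 = 1%N;
    shifts_mono : forall i j, (i < j < r)%N -> (s i < s j)%N;
    shifts_le : forall i, (i < r)%N -> (s i <= c)%N;
    shifts_cover : forall l, (d <= l < c + d)%N ->
      exists i j, [/\ (1 < i < r)%N, (j < d)%N & l = (j + s i)%N]
  }.

(** The shifts s_i with i >= 2 grow by d at each step, as fast as the covering
condition permits, until they have to slow down to end exactly at c. *)
Lemma shifts_exist c d r : (2 < r)%N -> (r - 1 <= c <= (r - 2) * d)%N ->
  exists s, admissible_shifts c d r s.
Proof.
move=> r_gt2 /andP[lb ub].
have d_gt1 : (1 < d)%N by nia.
pose s i := if (i <= 1)%N then i else minn (i.-1 * d) (c + i.+1 - r).
have s_top : s r.-1 = c.
  rewrite /s ifF; last by lia.
  have -> : r.-1.-1 = (r - 2)%N by lia.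
  lia.
have s_step i : (i.+1 < r)%N -> (s i < s i.+1)%N.
  case: i => [|[|i]] lt_i; rewrite /s /=; lia.
have s_mono i j : (i < j < r)%N -> (s i < s j)%N.
  move=> /andP[lt_ij]; elim: j lt_ij => // j IH; rewrite ltnS leq_eqVlt.
  case/predU1P=> [->|lt_ij] lt_j; first exact: s_step.
  exact: ltn_trans (IH lt_ij (ltnW lt_j)) (s_step j lt_j).
exists s; split=> // [i lt_i|l /andP[le_dl lt_l]].
  have [->|ne_i] := eqVneq i r.-1; first by rewrite s_top.
  by rewrite -s_top ltnW // s_mono //; lia.
(* The first interval ending beyond l starts at or before l, because it starts
   no later than the end of the previous one, or than d. *)
have ex_i : exists i, (1 < i < r)%N && (l < s i + d)%N.
  by exists r.-1; rewrite s_top lt_l andbT; lia.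
have [i /andP[i_bd lt_li] min_i] := ex_minnP ex_i.
have le_sl : (s i <= l)%N.
  have [i2|ne_i2] := eqVneq i 2; first by rewrite i2 /s /=; lia.
  have : (s i.-1 + d <= l)%N.
    rewrite leqNgt; apply/negP => lt_l'.
    by have := min_i i.-1; rewrite lt_l'; lia.
  apply: leq_trans; case: i {lt_li min_i} i_bd ne_i2 => [|[|[|i]]] //= _ _.
  by rewrite /s /= mulSn; lia.
by exists i, (l - s i)%N; split=> //; lia.
Qed.

(** * The Kronecker maps *)

Section KroneckerMaps.

Variable F : fieldType.
Variables (c d r : nat) (s : nat -> nat).
Hypothesis adm : admissible_shifts c d r s.

Definition fa_gen (i : 'I_2) : free_alg2 F := << 1 *g fmu i >>.

(** The arrow x_i over the free algebra: the shift by s_i, perturbed for i = 1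
in its last column by X on f_(d-1) and Y on f_(d-2). *)
Definition kron_mx (i : nat) : 'M[free_alg2 F]_(c + d, d) :=
  \matrix_(l, j) (1 *+ (l == j + s i :> nat)%N
    + (fa_gen 0 *+ (l == j :> nat) + fa_gen 1 *+ (l == j.-1 :> nat))
      *+ ((i == 1%N) && (j.+1 == d))).

Section Action.

Variables (n : nat) (N : fa_module F n).

Definition kron_act i (v : 'M[F]_(d, n)) : 'M[F]_(c + d, n) :=
  \matrix_l \sum_(j < d) fa_act N (kron_mx i l j) (row j v).

Lemma fa_act_mulb a (b : bool) y : fa_act N (a *+ b) y = fa_act N a y *+ b.
Proof. by case: b; rewrite ?fa_act0. Qed.

Lemma fa_act_gen i y : fa_act N (fa_gen i) y = y *m N i.
Proof. by rewrite /fa_gen fa_actU scale1r /word_act fmuE. Qed.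

Lemma kron_act_is_linear i : linear (kron_act i).
Proof.
move=> a u v; apply/row_matrixP => l; rewrite linearP /= !rowK.
rewrite scaler_sumr -big_split; apply: eq_bigr => j _ /=.
by rewrite !linearP.
Qed.

HB.instance Definition _ i :=
  GRing.isLinear.Build F 'M[F]_(d, n) 'M[F]_(c + d, n) _ (kron_act i)
    (kron_act_is_linear i).

Lemma kron_act_slot i j y : (j < d)%N ->
  kron_act i (slot d j y) = slot _ (j + s i) y
    + (slot _ j (y *m N 0) + slot _ j.-1 (y *m N 1))
      *+ ((i == 1%N) && (j.+1 == d)).
Proof.
move=> lt_jd; apply/row_matrixP => l.
rewrite linearD /= linearMn /= linearD /= !rowK.
rewrite (bigD1 (Ordinal lt_jd)) //= big1 ?addr0 => [|j' ne_j'].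
  rewrite !mxE /= rowK /= eqxx fa_actD !fa_act_mulb fa_actD !fa_act_mulb.
  by rewrite fa_act1 !fa_act_gen.
rewrite rowK -val_eqE /= in ne_j' *.
by rewrite (negPf ne_j') linear0.
Qed.

(** The component at f_l of the perturbation of x_1 (e_(d-1) (x) y). *)
Definition twist (y : 'rV[F]_n) l : 'rV[F]_n :=
  if l == d.-1 then y *m N 0 else if l == d.-2 then y *m N 1 else 0.

Lemma twist0 l : twist 0 l = 0.
Proof. by rewrite /twist !mul0mx !if_same. Qed.

Lemma twist_out y l : (d <= l)%N -> twist y l = 0.
Proof.
have [d_gt1 r_gt2 s0 s1 s_mono s_le s_cover] := adm.
by move=> le_dl; rewrite /twist !gtn_eqF //; lia.
Qed.

Lemma nrow_kron_act i v l : (i < r)%N -> (l < c + d)%N ->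
  nrow l (kron_act i v) = (if (s i <= l)%N then nrow (l - s i) v else 0)
    + (if i == 1%N then twist (nrow d.-1 v) l else 0).
Proof.
have [d_gt1 r_gt2 s0 s1 s_mono s_le s_cover] := adm.
move=> lt_ir lt_l; rewrite {1}[v]slot_sum linear_sum /= linear_sum /=.
have le_sc := s_le _ lt_ir.
have rowE (j : 'I_d) : nrow l (kron_act i (slot d j (nrow j v)))
    = (if l == (j + s i)%N then nrow j v else 0)
      + (if (i == 1%N) && (j.+1 == d) then twist (nrow j v) l else 0).
  have lt_jd := ltn_ord j.
  rewrite kron_act_slot // linearD /= nrow_slot; last by lia.
  congr (_ + _); first by case: eqP.
  case: andP => [[_ /eqP ej]|_]; last by rewrite linear0.
  rewrite linearD /= !nrow_slot /twist; try lia.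
  have -> : d.-2 = j.-1 by lia.
  have -> : d.-1 = j by lia.
  have [->|_] := eqVneq l j; first by rewrite gtn_eqF ?addr0 //; lia.
  by case: eqP; rewrite add0r.
rewrite (eq_bigr _ (fun j _ => rowE j)) big_split /=; congr (_ + _).
  case: leqP => le_sl; last first.
    by apply: big1 => j _; case: eqP => // el; move: le_sl; rewrite el; lia.
  have [lt_d|le_d] := ltnP (l - s i) d; last first.
    rewrite nrow_out // big1 // => j _; case: eqP => // el.
    by have := ltn_ord j; lia.
  rewrite (bigD1 (Ordinal lt_d)) //= subnK // eqxx big1 ?addr0 // => j.
  by rewrite -val_eqE /= => ne; case: eqP => // el; case/eqP: ne; lia.
case: (i == 1%N) => /=; last by rewrite big1.
have lt_d : (d.-1 < d)%N by lia.
rewrite (bigD1 (Ordinal lt_d)) //= (ltn_predK d_gt1) eqxx big1 ?addr0 // => j.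
by rewrite -val_eqE /= => ne; case: eqP => // el; case/eqP: ne; lia.
Qed.

(** Leading terms: with i0 and j0 the largest indices in the supports of alpha
and v, only alpha_(i0) v_(j0) contributes to the component at j0 + s_(i0),
because j + s_i increases strictly in both indices and the perturbation lies
below d = (d - 1) + s_1. *)
Lemma kron_act_inj (alpha : 'rV[F]_r) v :
  alpha != 0 -> \sum_(i < r) alpha 0 i *: kron_act i v = 0 -> v = 0.
Proof.
have [d_gt1 r_gt2 s0 s1 s_mono s_le s_cover] := adm.
move=> /rV0Pn[i1 nz1] xv0.
have [//|i0 nz_i0 max_i0] :=
  @arg_maxnP _ i1 (fun i => alpha 0 i != 0) (@nat_of_ord r).
apply/eqP/negPn/negP => nz_v.
have [j1 nzj1] : exists j : 'I_d, nrow j v != 0.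
  apply/existsP; apply: contraNT nz_v => /existsPn v0.
  apply/eqP/nrow_eq => j lt_j.
  by rewrite linear0; have /negPn/eqP := v0 (Ordinal lt_j).
have [//|j0 nz_j0 max_j0] :=
  @arg_maxnP _ j1 (fun j : 'I_d => nrow j v != 0) (@nat_of_ord d).
have nrow0 j : (j0 < j)%N -> nrow j v = 0.
  have [lt_j|le_d _] := ltnP j d; last exact: nrow_out.
  apply: contraTeq => nz; rewrite -leqNgt; exact: (max_j0 (Ordinal lt_j)).
have := congr1 (nrow (j0 + s i0)%N) xv0.
have lt_l : (j0 + s i0 < c + d)%N.
  by have := s_le _ (ltn_ord i0); have := ltn_ord j0; lia.
have twist_lead : (0 < s i0)%N -> twist (nrow d.-1 v) (j0 + s i0)%N = 0.
  move=> s_gt0; have [lt_j|ge_j] := ltnP j0 d.-1.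
    by rewrite nrow0 ?twist0.
  by apply: twist_out; lia.
rewrite linear0 linear_sum (bigD1 i0) //= linearZ /= nrow_kron_act //.
rewrite leq_addl addnK big1 ?addr0 => [|i ne_i]; last first.
  have [->|nz_i] := eqVneq (alpha 0 i) 0; first by rewrite scale0r linear0.
  have lt_i : (i < i0)%N.
    by rewrite ltn_neqAle (max_i0 i nz_i : (i <= i0)%N) andbT.
  have lt_s : (s i < s i0)%N by apply: s_mono; rewrite lt_i ltn_ord.
  rewrite linearZ /= nrow_kron_act // nrow0; last by lia.
  by rewrite twist_lead ?if_same ?addr0 ?scaler0 //; lia.
have -> :
    (if i0 == 1%N :> nat then twist (nrow d.-1 v) (j0 + s i0)%N else 0) = 0.
  by case: eqP => // ei0; rewrite twist_lead // ei0 s1.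
by rewrite addr0 => /eqP; rewrite scaler_eq0 (negPf nz_i0) (negPf nz_j0).
Qed.

End Action.

Section Homs.

Variables (n1 n2 : nat) (N1 : fa_module F n1) (N2 : fa_module F n2).
Variable phi : {linear 'M[F]_(d, n1) -> 'M[F]_(d, n2)}.
Variable psi : {linear 'M[F]_(c + d, n1) -> 'M[F]_(c + d, n2)}.
Hypothesis phi_psi : forall i v, (i < r)%N ->
  psi (kron_act N1 i v) = kron_act N2 i (phi v).

(** Both claims come from x_1 e_j = x_0 e_(j+1): the image of x_0 has no
component at f_d, where x_1 puts the last coordinate, and once that coordinate
is zero x_1 is the pure shift. *)
Lemma kron_hom_shift j y : (j.+1 < d)%N ->
  nrow d.-1 (phi (slot d j y)) = 0 /\
  forall l, nrow l (phi (slot d j.+1 y))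
    = if l is l'.+1 then nrow l' (phi (slot d j y)) else 0.
Proof.
have [d_gt1 r_gt2 s0 s1 s_mono s_le s_cover] := adm.
move=> lt_jd.
have eqT :
    kron_act N2 0 (phi (slot d j.+1 y)) = kron_act N2 1 (phi (slot d j y)).
  rewrite -!phi_psi ?kron_act_slot; try lia.
  by rewrite s0 s1 [j.+1 == d]ltn_eqF // !mulr0n addn0 addn1.
have eqTl l : (l < c + d)%N -> nrow l (phi (slot d j.+1 y))
    = (if (0 < l)%N then nrow l.-1 (phi (slot d j y)) else 0)
      + twist N2 (nrow d.-1 (phi (slot d j y))) l.
  move=> lt_l; have := congr1 (nrow l) eqT; rewrite !nrow_kron_act //; try lia.
  by rewrite s0 s1 subn0 subn1 addr0.
have cd1 : (d < c + d)%N by have := s_le 1%N; rewrite s1; lia.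
have last0 : nrow d.-1 (phi (slot d j y)) = 0.
  by have := eqTl d cd1; rewrite nrow_out // twist_out // addr0 ltnW.
split=> // l; have [lt_l|ge_l] := ltnP l d.
  by rewrite eqTl ?last0 ?twist0 ?addr0 //; [case: l {lt_l} | lia].
rewrite nrow_out //; case: l ge_l => // l.
rewrite leq_eqVlt => /predU1P[el|le_dl].
  by rewrite -last0; congr (nrow _ _); lia.
by rewrite nrow_out.
Qed.

(** A nonzero coordinate l > 0 in the image of e_0 would be shifted to the last
position in the image of e_(d-1-l). *)
Lemma kron_hom_slot j y :
  (j < d)%N -> phi (slot d j y) = slot d j (nrow 0 (phi (slot d 0 y))).
Proof.
have [d_gt1 r_gt2 s0 s1 s_mono s_le s_cover] := adm.
have shiftE : forall i l, (i < d)%N ->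
    nrow l (phi (slot d i y))
    = if (i <= l)%N then nrow (l - i) (phi (slot d 0 y)) else 0.
  elim=> [|i IH] l lt_i; first by rewrite subn0.
  have [_ ->] := kron_hom_shift y lt_i; case: l => // l.
  by rewrite IH ?subSS //; lia.
have top0 l : (0 < l)%N -> nrow l (phi (slot d 0 y)) = 0.
  move=> l_gt0; have [lt_l|] := ltnP l d; last exact: nrow_out.
  have lt_i : ((d.-1 - l).+1 < d)%N by lia.
  have [] := kron_hom_shift y lt_i; rewrite shiftE; last by lia.
  by rewrite leq_subr subKn //; lia.
move=> lt_j; apply: nrow_eq => l _; rewrite nrow_slot // shiftE //.
have [lt_l|] := ltnP l j; first by rewrite ltn_eqF.
rewrite leq_eqVlt => /predU1P[->|lt_jl]; first by rewrite subnn eqxx.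
by rewrite gtn_eqF // top0 //; lia.
Qed.

(** Fullness of N |-> (N^d, N^(c+d)); h is read off from the image of e_0, the
covering condition propagates it to all f_l, and x_1 e_(d-1) makes it linear
over k<X,Y>. *)
Lemma kron_full : exists h : 'M[F]_(n1, n2),
  [/\ forall i, N1 i *m h = h *m N2 i, forall v, phi v = v *m h
    & forall u, psi u = u *m h].
Proof.
have [d_gt1 r_gt2 s0 s1 s_mono s_le s_cover] := adm.
pose f := (nrow 0%N) \o phi \o slot d 0 : {linear 'rV[F]_n1 -> 'rV[F]_n2}.
pose h := lin1_mx f.
have fE y : nrow 0 (phi (slot d 0 y)) = y *m h by rewrite mul_rV_lin1.
have phiE j y : (j < d)%N -> phi (slot d j y) = slot d j (y *m h).
  by move=> lt_j; rewrite kron_hom_slot // fE.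
have psiE l y : (l < c + d)%N -> psi (slot _ l y) = slot _ l (y *m h).
  move=> lt_l; have [lt_ld|le_dl] := ltnP l d.
    have := phi_psi (i := 0) (slot d l y).
    rewrite phiE // !kron_act_slot //= s0 addn0 !mulr0n !addr0; apply; lia.
  have [|i [j [/andP[i_gt1 lt_i] lt_j ->]]] := s_cover l.
    by rewrite le_dl.
  have := phi_psi (slot d j y) lt_i.
  by rewrite phiE // !kron_act_slot // gtn_eqF // !mulr0n !addr0.
have cd1 : (d < c + d)%N by have := s_le 1%N; rewrite s1; lia.
have NhE (y : 'rV[F]_n1) :
    (y *m N1 0 *m h = y *m h *m N2 0) /\ (y *m N1 1 *m h = y *m h *m N2 1).
  have := phi_psi (i := 1) (slot d d.-1 y).
  rewrite phiE ?kron_act_slot; try lia.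
  rewrite s1 addn1 prednK ?eqxx /= ?mulr1n; try lia.
  rewrite !linearD /= !psiE; try lia.
  move=> /(_ (ltnW r_gt2)) /addrI eqs.
  by split; [have := congr1 (nrow d.-1) eqs | have := congr1 (nrow d.-2) eqs];
    rewrite !linearD /= !nrow_slot ?eqxx;
    rewrite ?[d.-1 == d.-2]gtn_eqF ?[d.-2 == d.-1]ltn_eqF; try lia;
    rewrite !mulr0n !mulr1n ?addr0 ?add0r.
exists h; split.
- by move=> i; apply/row_matrixP => q; rewrite !rowE !mulmxA;
    case: i => [[|[|//]] ?];
    set o := Ordinal _; [rewrite (_ : o = 0) | rewrite (_ : o = 1)];
    try exact: val_inj; case: (NhE (delta_mx (0 : 'I_1) q)).
- move=> v; rewrite {1}[v]slot_sum [in RHS](slot_sum v) mulmx_suml linear_sum.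
  by apply: eq_bigr => j _; rewrite slotM phiE.
- move=> v; rewrite {1}[v]slot_sum [in RHS](slot_sum v) mulmx_suml linear_sum.
  by apply: eq_bigr => j _; rewrite slotM psiE.
Qed.

End Homs.
End KroneckerMaps.

(** * The bimodule and its tensor products *)

Section Modules.

Variables (F : fieldType) (gT : finGroupType) (E : {group gT}).
Variables (cEE : abelian E).
Variables (c d r : nat) (s : nat -> nat).
Hypothesis adm : admissible_shifts c d r s.
Variables (g : 'I_r -> gT) (chi : gT -> 'I_r -> F).
Hypothesis gE : forall i, g i \in E.
Hypothesis chiM :
  forall i, {in E &, {morph chi ^~ i : x y / (x * y)%g >-> x + y}}.
Hypothesis chi_g : forall i j, chi (g j) i = (j == i)%:R.

Definition lower_mx (x : gT) : 'M[free_alg2 F]_(c + d, d) :=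
  \matrix_(l, j) \sum_(i < r) chi x i *: kron_mx F c d s i l j.

(** 1 + sum_i chi_i(x) x_i, which is multiplicative in x because chi is additive
and the arrows compose to zero. *)
Definition kron_bimod_mx (x : gT) : 'M[free_alg2 F]_(d + (c + d)) :=
  block_mx 1%:M 0 (lower_mx x) 1%:M.

Lemma kron_bimod_mx1 : kron_bimod_mx 1%g = 1%:M.
Proof.
rewrite /kron_bimod_mx; have -> : lower_mx 1%g = 0.
  apply/matrixP => l j; rewrite !mxE big1 // => i _.
  have := chiM i (group1 E) (group1 E).
  by rewrite mulg1 -[LHS]addr0 => /addrI <-; rewrite scale0r.
by rewrite -scalar_mx_block.
Qed.

Lemma kron_bimod_mxM : {in E &, forall x y,
  kron_bimod_mx (x * y)%g = kron_bimod_mx x *m kron_bimod_mx y}.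
Proof.
move=> x y Ex Ey; rewrite /kron_bimod_mx.
have -> : lower_mx (x * y)%g = lower_mx x + lower_mx y.
  apply/matrixP => l j; rewrite !mxE -big_split.
  by apply: eq_bigr => i _; rewrite chiM // scalerDl.
by rewrite mulmx_block !(mulmx1, mul1mx, mulmx0, mul0mx, addr0, add0r).
Qed.

Definition kron_bimod : free_bimodule F E (d + (c + d)) :=
  FreeBimodule kron_bimod_mx1 kron_bimod_mxM.

Lemma fa_actZ n (N : fa_module F n) a b y :
  fa_act N (a *: b) y = a *: fa_act N b y.
Proof. by rewrite -mul_malgC fa_actM fa_actU /word_act fm1. Qed.

Lemma tensor_act_kron n (N : fa_module F n) x v u :
  tensor_act kron_bimod N x (col_mx v u)
  = col_mx v (\sum_(i < r) chi x i *: kron_act c s N i v + u).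
Proof.
apply/row_matrixP => i; rewrite rowK big_split_ord /=.
under eq_bigr => j _ do rewrite rowKu.
under [X in _ + X]eq_bigr => j _ do rewrite rowKd.
rewrite -[i]splitK; case: split => l /=.
  under eq_bigr => j _ do rewrite block_mxEul mxE.
  under [X in _ + X]eq_bigr => j _ do rewrite block_mxEur mxE fa_act0.
  rewrite big1_eq addr0 rowKu (bigD1 l) //= eqxx fa_act1 big1 ?addr0 // => j.
  by rewrite eq_sym => /negPf ->; rewrite fa_act0.
under eq_bigr => j _ do rewrite block_mxEdl mxE.
under [X in _ + X]eq_bigr => j _ do rewrite block_mxEdr mxE.
rewrite rowKd linearD /=; congr (_ + _); last first.
  rewrite (bigD1 l) //= eqxx fa_act1 big1 ?addr0 // => j.
  by rewrite eq_sym => /negPf ->; rewrite fa_act0.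
rewrite linear_sum /=; under eq_bigr => j _ do rewrite fa_act_sum.
rewrite exchange_big /=; apply: eq_bigr => q _.
rewrite linearZ /= rowK scaler_sumr; apply: eq_bigr => j _.
by rewrite fa_actZ.
Qed.

Definition top_incl n (v : 'M[F]_(d, n)) : 'M_(d + (c + d), n) := col_mx v 0.

Definition bot_incl n (u : 'M[F]_(c + d, n)) : 'M_(d + (c + d), n) :=
  col_mx 0 u.

Lemma top_incl_linear n : linear (@top_incl n).
Proof.
by move=> a v w; rewrite /top_incl scale_col_mx add_col_mx scaler0 addr0.
Qed.

Lemma bot_incl_linear n : linear (@bot_incl n).
Proof.
by move=> a v w; rewrite /bot_incl scale_col_mx add_col_mx scaler0 addr0.
Qed.

HB.instance Definition _ n :=
  GRing.isLinear.Build F _ _ _ (@top_incl n) (@top_incl_linear n).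
HB.instance Definition _ n :=
  GRing.isLinear.Build F _ _ _ (@bot_incl n) (@bot_incl_linear n).

Local Notation M N := (tensor_repr kron_bimod N cEE).

Lemma tensor_kronE n (N : fa_module F n) x w :
  mxvec w *m M N x = mxvec (tensor_act kron_bimod N x w).
Proof. by rewrite mul_rV_lin /= mxvecK. Qed.

Lemma tensor_act_gen n (N : fa_module F n) i w :
  tensor_act kron_bimod N (g i) w = w + bot_incl (kron_act c s N i (usubmx w)).
Proof.
rewrite -{1 2}[w]vsubmxK tensor_act_kron /bot_incl add_col_mx addr0.
rewrite [dsubmx w + _]addrC (bigD1 i) //= chi_g eqxx scale1r.
rewrite [X in _ + X + _]big1 ?addr0 // => j ne_ji.
by rewrite chi_g eq_sym (negPf ne_ji) scale0r.
Qed.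

Lemma x_op_kron n (N : fa_module F n) alpha w :
  mxvec w *m x_op g (M N) alpha
  = mxvec (col_mx 0 (\sum_(i < r) alpha 0 i *: kron_act c s N i (usubmx w))).
Proof.
rewrite mulmx_sumr -/(bot_incl _) !linear_sum; apply: eq_bigr => i _ /=.
rewrite -scalemxAr !linearZ /= mulmxBr mulmx1 tensor_kronE tensor_act_gen.
by congr (_ *: _); rewrite linearD /= addrC addKr.
Qed.

Lemma ker_x_op_kron n (N : fa_module F n) alpha w : alpha != 0 ->
  (mxvec w <= kermx (x_op g (M N) alpha))%MS = (usubmx w == 0).
Proof.
move=> nz_alpha; rewrite (sameP sub_kermxP eqP) x_op_kron.
apply/eqP/eqP=> [eq0|->]; last first.
  by rewrite big1 ?col_mx0 ?linear0 // => i _; rewrite linear0 scaler0.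
have := congr1 vec_mx eq0.
rewrite mxvecK linear0 -[RHS]col_mx0 => /eq_col_mx[_].
exact: (kron_act_inj adm).
Qed.

Lemma equal_kernels_kron n (N : fa_module F n) : equal_kernels g (M N).
Proof.
move=> alpha beta nz_a nz_b; apply/andP; split; apply/rV_subP => v;
  by rewrite -[v]vec_mxK !ker_x_op_kron.
Qed.

(** x_alpha has the same kernel as the projection onto N^d. *)
Lemma rank_x_op_kron n (N : fa_module F n) alpha : alpha != 0 ->
  \rank (x_op g (M N) alpha) = (d * n)%N.
Proof.
move=> nz_alpha; set A := x_op _ _ _.
pose pr : 'M[F]_((d + (c + d)) * n, d * n) :=
  lin1_mx (mxvec \o usubmx \o vec_mx).
have prE u : u *m pr = mxvec (usubmx (vec_mx u)) by rewrite mul_rV_lin1.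
have full_pr : row_full pr.
  rewrite -sub1mx; apply/rV_subP => v _.
  apply/submxP; exists (mxvec (col_mx (vec_mx v) 0)).
  by rewrite prE mxvecK col_mxKu vec_mxK.
have eq_ker : (kermx A :=: kermx pr)%MS.
  apply/eqmxP/andP; split; apply/rV_subP => v;
    by rewrite -[v]vec_mxK ker_x_op_kron // (sameP sub_kermxP eqP) prE mxvecK
      mxvec_eq0.
have := mxrank_ker A; rewrite eq_ker mxrank_ker (eqP full_pr).
have := rank_leq_row A; nia.
Qed.

Lemma constant_jordan_kron n (N : fa_module F n) :
  constant_jordan_type12 g (M N) (c * n) (d * n).
Proof.
move=> alpha nz_alpha.
apply: (square_zero_similar (b := d * n) (c := c * n)).
- lia.
- rewrite -(big_mkord xpredT (nth 0%N _)) -(big_nth 0%N xpredT id).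
  rewrite big_cat !big_nseq /= !iter_addn_0; lia.
- apply/row_matrixP => i; rewrite row_mul row0; apply/sub_kermxP.
  rewrite rowE -[delta_mx _ _]vec_mxK x_op_kron ker_x_op_kron //.
  by rewrite col_mxKu.
- by apply: nilp_jordan12_square_zero; rewrite all_cat !all_nseq !orbT.
- exact: rank_x_op_kron.
- exact: rank_nilp_jordan12.
Qed.

Section Homs.

Variables (n1 n2 : nat) (N1 : fa_module F n1) (N2 : fa_module F n2).
Variable B : 'M[F]_((d + (c + d)) * n1, (d + (c + d)) * n2).
Hypothesis homB : forall x, x \in E -> M N1 x *m B = B *m M N2 x.

Definition vec_hom :=
  vec_mx \o mulmxr B \o mxvec :
    {linear 'M[F]_(d + (c + d), n1) -> 'M[F]_(d + (c + d), n2)}.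

(** On N^(c+d) the homomorphism is h; on the whole module it is h only modulo
N^(c+d), as a homomorphism may add any map from the top N^d to N'^(c+d). *)
Lemma kron_hom : exists h : 'M[F]_(n1, n2),
  [/\ forall i, N1 i *m h = h *m N2 i,
      forall w, usubmx (vec_hom w) = usubmx w *m h
    & forall u, vec_hom (bot_incl u) = bot_incl (u *m h)].
Proof.
have [d_gt1 r_gt2 s0 s1 s_mono s_le s_cover] := adm.
have hom_act (i : 'I_r) v u : vec_hom (bot_incl (kron_act c s N1 i v))
    = bot_incl (kron_act c s N2 i (usubmx (vec_hom (col_mx v u)))).
  apply: (addrI (vec_hom (col_mx v u))); rewrite -tensor_act_gen -linearD.
  rewrite -{2}[v](col_mxKu v u) -tensor_act_gen; apply: (can_inj mxvecK).
  by rewrite -!tensor_kronE /= !vec_mxK -tensor_kronE -!mulmxA homB ?gE.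
(* The x_i kill the image of N^(c+d), which therefore lies in N'^(c+d) by
   injectivity of a single one of them. *)
have bot_stable u : usubmx (vec_hom (bot_incl u)) = 0.
  pose i0 := Ordinal (ltnW (ltnW r_gt2)).
  pose alpha : 'rV[F]_r := delta_mx 0 i0.
  have nz_alpha : alpha != 0.
    by apply/rV0Pn; exists i0; rewrite mxE !eqxx oner_eq0.
  apply: (kron_act_inj adm (N := N2) nz_alpha).
  rewrite (bigD1 i0) //= big1 => [|i ne_i]; last first.
    by rewrite mxE (negPf ne_i) andbF scale0r.
  have := hom_act i0 0 u; rewrite !linear0 => /esym/(congr1 dsubmx).
  by rewrite col_mxKd linear0 => ->; rewrite scaler0 addr0.
pose phi : {linear 'M[F]_(d, n1) -> 'M[F]_(d, n2)} :=
  usubmx \o vec_hom \o @top_incl n1.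
pose psi : {linear 'M[F]_(c + d, n1) -> 'M[F]_(c + d, n2)} :=
  dsubmx \o vec_hom \o @bot_incl n1.
have phi_psi i v :
    (i < r)%N -> psi (kron_act c s N1 i v) = kron_act c s N2 i (phi v).
  move=> lt_i; apply: etrans (congr1 dsubmx (hom_act (Ordinal lt_i) v 0)) _.
  exact: col_mxKd.
have [h [Nh phih psih]] := kron_full adm phi_psi.
exists h; split=> // [w|u].
  have {1}-> : w = top_incl (usubmx w) + bot_incl (dsubmx w).
    by rewrite /top_incl /bot_incl add_col_mx addr0 add0r vsubmxK.
  have uD a b :
      usubmx (vec_hom (a + b)) = usubmx (vec_hom a) + usubmx (vec_hom b).
    exact: (linearD (usubmx \o vec_hom)).
  by rewrite uD bot_stable addr0; apply: phih.
rewrite -[vec_hom _]vsubmxK bot_stable; congr (col_mx _ _); exact: psih.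
Qed.

End Homs.

Lemma kron_reflects_iso n1 n2 (N1 : fa_module F n1) (N2 : fa_module F n2) :
  mx_rsim (M N1) (M N2) -> fa_isomorphic N1 N2.
Proof.
have [d_gt1 r_gt2 s0 s1 s_mono s_le s_cover] := adm.
case=> B eq_dim Bfree homB.
have [h [Nh _ both]] := kron_hom homB.
have en : n1 = n2.
  by apply/eqP; rewrite -(eqn_pmul2l (_ : 0 < d + (c + d))%N) ?eq_dim //; lia.
have hfree : row_free h.
  rewrite -kermx_eq0; apply/eqP/row_matrixP => i; rewrite row0.
  set y := row i _; have yh0 : y *m h = 0 by rewrite -row_mul mulmx_ker row0.
  have slot0 : bot_incl (slot (c + d) 0 y) = 0.
    have := both (slot (c + d) 0 y); rewrite slotM yh0 !linear0.
    move=> /(congr1 mxvec); rewrite /= vec_mxK linear0 -(mul0mx _ B).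
    by move=> /(row_free_inj Bfree)/(congr1 vec_mx); rewrite mxvecK linear0.
  have := congr1 (nrow 0 \o dsubmx) slot0.
  by rewrite /= col_mxKd !linear0 nrow_slot //; lia.
exists h; split=> //.
by rewrite /row_full (eqP hfree) en.
Qed.

(** The induced h splits N as im h (+) im (1 - h), so it is 0 or 1. The
idempotent z |-> e z, respectively z |-> z - e z, then maps into N^(c+d) and vanishes
there, so it is zero. *)
Lemma kron_idempotent n (N : fa_module F n) e :
    fa_indecomposable N -> (forall x, x \in E -> M N x *m e = e *m M N x) ->
  e *m e = e -> e = 0 \/ e = 1%:M.
Proof.
have [d_gt1 r_gt2 s0 s1 s_mono s_le s_cover] := adm.
move=> [n_gt0 indN] hom_e ee.
have [h [Nh toph both]] := kron_hom hom_e.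
have ve w : vec_hom e (vec_hom e w) = vec_hom e w.
  by rewrite /= vec_mxK -mulmxA ee.
have topE (y : 'rV[F]_n) (y' : 'rV[F]_n) : slot d 0 y = slot d 0 y' -> y = y'.
  by move/(congr1 (nrow 0)); rewrite !nrow_slot //; lia.
have hh : h *m h = h.
  apply/row_matrixP => i; rewrite !rowE; apply: topE.
  have := congr1 usubmx (ve (top_incl (slot d 0 (delta_mx 0 i)))).
  by rewrite !toph col_mxKu !slotM mulmxA.
have bot_eq0 z : usubmx z = 0 -> z = bot_incl (dsubmx z).
  by move=> z0; rewrite -{1}[z]vsubmxK z0.
have vE w : mxvec w *m e = mxvec (vec_hom e w) by rewrite /= vec_mxK.
case: (indN h (1%:M - h)) => [i|i||| h0|h1].
- by rewrite -Nh submxMl.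
- by rewrite mulmxBl mul1mx -Nh -{1}[N i]mulmx1 -mulmxBr submxMl.
- apply/andP; split; first exact: submx1.
  by rewrite -{1}(subrKC h 1%:M) addmx_sub_adds.
- apply/eqP/rowV0P => v; rewrite sub_capmx.
  case/andP => [/submxP[a va] /submxP[b vb]].
  have vh : v *m h = v by rewrite va -mulmxA hh.
  by rewrite -vh vb -mulmxA mulmxBl mul1mx hh subrr mulmx0.
- left; apply/row_matrixP => i; rewrite row0 rowE -[delta_mx _ _]vec_mxK vE.
  set w := vec_mx _; rewrite -ve; set z := vec_hom e w.
  have z_bot : z = bot_incl (dsubmx z).
    by apply: bot_eq0; rewrite toph h0 mulmx0.
  by rewrite z_bot both h0 mulmx0 !linear0.
- have {}h1 : h = 1%:M by apply/esym/eqP; rewrite -subr_eq0 h1.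
  right; apply/row_matrixP => i; rewrite !rowE mulmx1 -[delta_mx _ _]vec_mxK vE.
  congr mxvec; set w := vec_mx _; apply/esym/eqP; rewrite -subr_eq0; apply/eqP.
  set z := w - _.
  have z_bot : z = bot_incl (dsubmx z).
    by apply: bot_eq0; rewrite /z linearB /= [X in _ - X]toph h1 mulmx1 subrr.
  have : vec_hom e z = 0 by rewrite /z linearB [X in _ - X]ve subrr.
  by rewrite z_bot both h1 mulmx1.
Qed.

Lemma kron_preserves_indecomposable n (N : fa_module F n) :
  fa_indecomposable N -> mx_indecomposable (M N).
Proof.
have [d_gt1 r_gt2 s0 s1 s_mono s_le s_cover] := adm.
move=> indN; have [n_gt0 _] := indN; split=> [|U V modU modV addUV capUV].
  by rewrite muln_gt0 n_gt0 andbT; lia.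
pose e := proj_mx U V.
have hom_e x : x \in E -> M N x *m e = e *m M N x.
  move=> Ex; have /hom_mxP/(_ x Ex) : (1%:M <= dom_hom_mx (M N) e)%MS.
    by rewrite -(eqmxP addUV) proj_mx_hom.
  by rewrite !mul1mx.
have [e0|e1] := kron_idempotent indN hom_e (proj_mx_proj capUV).
  by left; rewrite -[U](proj_mx_id capUV (submx_refl U)) -/e e0 mulmx0.
by right; rewrite -[V]mulmx1 -e1 (proj_mx_0 capUV).
Qed.

End Modules.

(** * Wild representation type *)

Theorem corollary4p5 (k : closedFieldType) (p : nat) (charkp : p \in [pchar k])
    (r : nat) (hr : (3 <= r)%N)
    (gT : finGroupType) (E : {group gT}) (abelE : (p.-abelem E)%g)
    (rankE : 'r(E)%g = r)
    (g : 'I_r -> gT) (genE : <<[set g i | i : 'I_r]>>%g = E)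
    (c d : nat) (hcd : (r - 1 <= c <= (r - 2) * d)%N) :
  wild_representation_type (abelem_abelian abelE)
    (fun n (M : mx_representation k E n) =>
       equal_kernels g M /\
       exists t : nat, (0 < t)%N /\ constant_jordan_type12 g M (c * t)%N (d * t)%N).
Proof.
have [s adm] := shifts_exist hr hcd.
have r_gt0 : (0 < r)%N by lia.
have [chi [chiM chi_g]] := abelem_coordinates charkp abelE rankE r_gt0 genE.
have gE i : g i \in E by rewrite -genE mem_gen // imset_f.
exists (d + (c + d))%N, (kron_bimod c d s chiM); split.
- move=> n N n_gt0; split; first exact: (equal_kernels_kron _ adm).
  exists n; split=> //; exact: (constant_jordan_kron _ adm).
- by move=> n N indN; apply: (kron_preserves_indecomposable _ adm gE).
- by move=> n1 N1 n2 N2 _ _; apply: (kron_reflects_iso adm gE).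
Qed.
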